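(* Both Banach algebras $A$ and $B$ have the property of direct finiteness: for $a,b$ in the algebra, $ba=1$ if and only if $ab=1$.
   Context: $\mathbb{T}$ is the unit circle. $W$ denotes the Wiener algebra of continuous complex functions on $\mathbb{T}$ with absolutely convergent Fourier series; for $\phi\in W$, $\|\phi\|_1$ is the sum of the absolute values of its Fourier coefficients. $A$ is the Banach algebra of formal series $a=\sum_{m=0}^\infty x^m\phi_m$ (also written $\sum x^m\phi_m(y)$) with $\phi_m\in W$ and $\|a\|=\sum_m\|\phi_m\|_1<\infty$. $B$ is the Banach algebra of formal series $b=\sum_{m=0}^\infty x^m\phi_m$ with $\phi_m\in C(\mathbb{T})$ and $\|b\|=\sum_m\|\phi_m\|_\infty<\infty$. Here $y$ is identified with the function $\zeta\mapsto\zeta$, and in both algebras the product is determined by $(x^m\phi)(x^n\psi)=x^{m+n}\,\phi(\zeta^{2^n})\psi(\zeta)$; in particular $yx=xy^2$ and $y$ is invertible. *)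

(* Defs.v *)
From HB Require Import structures.
From mathcomp Require Import all_boot all_order all_algebra complex.
From mathcomp Require Import all_classical all_reals all_analysis.

Set Implicit Arguments.
Unset Strict Implicit.
Unset Printing Implicit Defensive.

Import Order.TTheory GRing.Theory Num.Theory.
Import numFieldNormedType.Exports.

Local Open Scope classical_set_scope.
Local Open Scope ring_scope.

(* [R[i]^o] is [R[i]]; the alias carries the topology given by the modulus, *)
(* and the circle, as a subtype of it, gets the induced topology.           *)
Definition circle (R : realType) : set R[i]^o := [set z | `|z : R[i]| = 1].

Arguments circle R : clear implicits.

Section Circle.
Context {R : realType}.

Definition circle_val (z : circle R) : R[i] := \val z.

Lemma circle_valP (z : circle R) : `|circle_val z| = 1.
Proof. exact: (set_mem (valP z)). Qed.

Lemma circle_val_inj : injective circle_val.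
Proof. exact: val_inj. Qed.

Definition circle_mk (z : R[i]) (hz : `|z| = 1) : circle R :=
  SigSub (mem_set hz : (z : R[i]^o) \in circle R).

Fact circle_exp_subproof (z : circle R) (k : nat) : `|circle_val z ^+ k| = 1.
Proof. by rewrite normrX circle_valP expr1n. Qed.

Definition circle_exp (z : circle R) (k : nat) : circle R :=
  circle_mk (circle_exp_subproof z k).

Lemma circle_exp1 z : circle_exp z 1 = z.
Proof. exact: circle_val_inj. Qed.

Lemma circle_expM z j k : circle_exp (circle_exp z j) k = circle_exp z (j * k).
Proof. by apply: circle_val_inj; rewrite /circle_val /= exprM. Qed.

Fact circle_expi_subproof (t : R) : `|(cos t +i* sin t)%C| = 1.
Proof. by rewrite normc_def /= cos2Dsin2 sqrtr1. Qed.

Definition circle_expi (t : R) : circle R := circle_mk (circle_expi_subproof t).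

Definition modulus (z : R[i]) : R := complex.Re `|z|.

Definition sup_norm (phi : circle R -> R[i]) : \bar R :=
  ereal_sup (range (fun z => (modulus (phi z))%:E)).

Definition circle_continuous (phi : circle R -> R[i]) : Prop :=
  continuous (phi : circle R -> R[i]^o).

(* (2 pi)^-1 \int_0^(2 pi) phi(e^(it)) e^(-ikt) dt *)
Definition fourier_coef (phi : circle R -> R[i]) (k : int) : R[i] :=
  let f t := phi (circle_expi t) * circle_val (circle_expi t) ^ (- k) in
  let I (g : R -> R) := (\int[lebesgue_measure]_(t in `[0, 2 * pi]) g t)%R in
  (((2 * pi)^-1 * I (fun t => complex.Re (f t))) +i*
   ((2 * pi)^-1 * I (fun t => complex.Im (f t))))%C.

Definition wiener_norm (phi : circle R -> R[i]) : \bar R :=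
  (\esum_(k in [set: int]) (modulus (fourier_coef phi k))%:E)%E.

Definition wiener (phi : circle R -> R[i]) : Prop :=
  circle_continuous phi /\ (wiener_norm phi < +oo)%E.

End Circle.

(* Formal series [\sum_m x^m phi_m] with arbitrary coefficient functions on   *)
(* the circle. A record rather than an alias, so that the pointwise structure *)
(* of functions is not inferred for it.                                       *)
Record skew_series (R : realType) :=
  SkewSeries { coef : nat -> circle R -> R[i] }.

HB.instance Definition _ (R : realType) := gen_eqMixin (skew_series R).
HB.instance Definition _ (R : realType) := gen_choiceMixin (skew_series R).

Section SkewSeriesRing.
Context {R : realType}.
Implicit Types a b c : skew_series R.

Lemma skew_seriesP a b : (forall m z, coef a m z = coef b m z) -> a = b.
Proof.
case: a b => [a] [b] /= ab; congr SkewSeries.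
by apply/funext => m; apply/funext => z.
Qed.

Definition series_zero : skew_series R := SkewSeries (fun _ _ => 0).
Definition series_opp a := SkewSeries (fun m z => - coef a m z).
Definition series_add a b := SkewSeries (fun m z => coef a m z + coef b m z).
Definition series_one : skew_series R := SkewSeries (fun m _ => (m == 0)%:R).

(* From (x^i phi) (x^j psi) = x^(i+j) phi(z^(2^j)) psi(z), with i = m - j. *)
Definition series_mul a b := SkewSeries (fun m z =>
  \sum_(j < m.+1) coef a (m - j) (circle_exp z (2 ^ j)) * coef b j z).

Fact series_addA : associative series_add.
Proof. by move=> a b c; apply: skew_seriesP => m z; exact: addrA. Qed.

Fact series_addC : commutative series_add.
Proof. by move=> a b; apply: skew_seriesP => m z; exact: addrC. Qed.

Fact series_add0 : left_id series_zero series_add.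
Proof. by move=> a; apply: skew_seriesP => m z; exact: add0r. Qed.

Fact series_addN : left_inverse series_zero series_opp series_add.
Proof. by move=> a; apply: skew_seriesP => m z; exact: addNr. Qed.

HB.instance Definition _ := GRing.isZmodule.Build (skew_series R)
  series_addA series_addC series_add0 series_addN.

Fact series_mulA : associative series_mul.
Proof.
move=> a b c; apply: skew_seriesP => m z /=.
pose F (k j : nat) := coef a (m - k) (circle_exp z (2 ^ k)) *
  (coef b (k - j) (circle_exp z (2 ^ j)) * coef c j z).
transitivity (\sum_(k < m.+1) \sum_(j < m.+1 | (j <= k)%N) F k j).
  apply: eq_bigr => k _; rewrite mulr_sumr.
  by rewrite (big_ord_narrow_leq (ltn_ord k : (k <= m)%N)).
rewrite (exchange_big_dep predT) //=; apply: eq_bigr => j _.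
have jm : (j <= m)%N by rewrite -ltnS.
rewrite mulr_suml -(big_mkord (fun k => j <= k)%N (F^~ j)).
rewrite (@big_cat_nat _ _ _ j) //=; last exact: leqW.
rewrite big_nat_cond big1 ?add0r; last first.
  by move=> k /andP[/andP[_ kj]]; rewrite leqNgt kj.
rewrite -{1}[j : nat]add0n big_addn subSn // big_mkord.
apply: eq_big => [k|k _]; first by rewrite leq_addl.
by rewrite /F addnK circle_expM -expnD -subnDA [(j + k)%N]addnC mulrA.
Qed.

Fact series_mul1 : left_id series_one series_mul.
Proof.
move=> a; apply: skew_seriesP => m z /=.
rewrite big_ord_recr /= subnn mul1r big1 ?add0r // => j _.
by rewrite subn_eq0 leqNgt ltn_ord mul0r.
Qed.

Fact series_mulr1 : right_id series_one series_mul.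
Proof.
move=> a; apply: skew_seriesP => m z /=.
rewrite big_ord_recl /= subn0 expn0 circle_exp1 mulr1 big1 ?addr0 // => j _.
by rewrite mulr0.
Qed.

Fact series_mulDl : left_distributive series_mul series_add.
Proof.
move=> a b c; apply: skew_seriesP => m z /=; rewrite -big_split /=.
by apply: eq_bigr => j _; rewrite mulrDl.
Qed.

Fact series_mulDr : right_distributive series_mul series_add.
Proof.
move=> a b c; apply: skew_seriesP => m z /=; rewrite -big_split /=.
by apply: eq_bigr => j _; rewrite mulrDr.
Qed.

HB.instance Definition _ := GRing.Zmodule_isPzRing.Build (skew_series R)
  series_mulA series_mul1 series_mulr1 series_mulDl series_mulDr.

Definition monomial (n : nat) (phi : circle R -> R[i]) : skew_series R :=
  SkewSeries (fun m z => if m == n then phi z else 0).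

Lemma monomialM i j (phi psi : circle R -> R[i]) :
  monomial i phi * monomial j psi =
  monomial (i + j) (fun z => phi (circle_exp z (2 ^ j)) * psi z).
Proof.
apply: skew_seriesP => m z /=.
have [->|mij] := eqVneq.
  have jlt : (j < (i + j).+1)%N by rewrite ltnS leq_addl.
  rewrite (bigD1 (Ordinal jlt)) //= addnK !eqxx big1 ?addr0 // => k.
  by rewrite -val_eqE /= => /negPf ->; rewrite mulr0.
apply: big1 => k _; have [mki|] := eqVneq; last by rewrite mul0r.
have [kj|] := eqVneq; last by rewrite mulr0.
by case/eqP: mij; rewrite -mki -kj subnK // -ltnS.
Qed.

Definition series_x : skew_series R := monomial 1 (fun=> 1).
Definition series_y : skew_series R := monomial 0 circle_val.

Lemma series_yx : series_y * series_x = series_x * series_y ^+ 2.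
Proof.
rewrite expr2 !monomialM; congr monomial; apply/funext => z.
by rewrite expn1 expn0 circle_exp1 mulr1 mul1r.
Qed.

Definition algebraA_norm a : \bar R := (\sum_(m <oo) wiener_norm (coef a m))%E.

Definition algebraA : set (skew_series R) :=
  [set a | (forall m, wiener (coef a m)) /\ (algebraA_norm a < +oo)%E].

Definition algebraB_norm b : \bar R := (\sum_(m <oo) sup_norm (coef b m))%E.

Definition algebraB : set (skew_series R) :=
  [set b | (forall m, circle_continuous (coef b m)) /\
           (algebraB_norm b < +oo)%E].

End SkewSeriesRing.

Arguments algebraA R : clear implicits.
Arguments algebraB R : clear implicits.

(* Main.v *)
Require Import Defs.
From mathcomp Require Import all_boot all_order all_algebra complex.
From mathcomp Require Import all_classical all_reals all_analysis.

Import Order.TTheory GRing.Theory Num.Theory.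
Local Open Scope ring_scope.

(** Direct finiteness is inherited from the ring of all formal skew series with
    arbitrary coefficient functions ([series_direct_finite]). If [b * a = 1],
    then [e = 1 - a * b] is idempotent. Its constant coefficient is
    [1 - a_0 b_0], which vanishes because [b_0 a_0 = 1] and functions on the
    circle commute. Hence [e], being equal to [e ^+ n] for every [n > 0], has no
    term of degree less than [n] in [x], so [e = 0] ([series_idempotent_eq0]). *)

(** The coefficients vanish by strong induction on the degree: each term of the
    degree [m] coefficient of [e * e] contains [coef e j] with [j < m], or
    [coef e 0]. *)
Lemma series_idempotent_eq0 (R : realType) (e : skew_series R) :
  e * e = e -> (forall z, coef e 0 z = 0) -> e = 0.
Proof.
move=> ee e0; apply: skew_seriesP => m.
elim/ltn_ind: m => -[|m] IHm z; first exact: e0.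
rewrite -ee /= big1 // => j _.
have [jm|mj] := ltnP j m.+1; first by rewrite (IHm _ jm) mulr0.
have -> : j = m.+1 :> nat by apply/eqP; rewrite eqn_leq mj -ltnS ltn_ord.
by rewrite subnn e0 mul0r.
Qed.

Lemma coef0M (R : realType) (a b : skew_series R) z :
  coef (a * b) 0 z = coef a 0 z * coef b 0 z.
Proof. by rewrite /= big_ord1 expn0 circle_exp1. Qed.

Lemma series_direct_finite (R : realType) (a b : skew_series R) :
  b * a = 1 -> a * b = 1.
Proof.
move=> ba1; apply/esym/eqP; rewrite -subr_eq0; apply/eqP.
apply: series_idempotent_eq0 => [|z].
  have abab : a * b * (a * b) = a * b by rewrite mulrA -(mulrA a) ba1 mulr1.
  by rewrite mulrBr mulr1 mulrBl mul1r abab subrr subr0.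
have -> : coef (1 - a * b) 0 z = 1 - coef (a * b) 0 z by [].
by rewrite coef0M mulrC -coef0M ba1 subrr.
Qed.

Theorem mainTheorem5 (R : realType) :
  (forall a b : skew_series R, algebraA R a -> algebraA R b ->
     (b * a = 1 <-> a * b = 1)) /\
  (forall a b : skew_series R, algebraB R a -> algebraB R b ->
     (b * a = 1 <-> a * b = 1)).
Proof. by split=> a b _ _; split; exact: series_direct_finite. Qed.
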